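(* Let $N\ge2$ and let $\Omega\subset\mathbb{R}^N$ be a bounded domain with boundary $\Gamma$ satisfying the uniform interior and exterior sphere conditions with radii $r_i$ and $r_e$, and let $u\in C^1(\overline\Omega)\cap C^2(\Omega)$ be a solution of $\Delta u=N$ in $\Omega$, $u=0$ on $\Gamma$. Then $$r_i\le|\nabla u|\le c_N\,\frac{d_\Omega(d_\Omega+r_e)}{r_e}\quad\text{on }\Gamma,$$ where $d_\Omega$ is the diameter of $\Omega$, $c_N=3/2$ for $N=2$ and $c_N=N/2$ for $N\ge3$.
   Context: Uniform interior (resp. exterior) sphere condition with radius $r_i$ (resp. $r_e$): for every $p\in\Gamma$ there is a ball of radius $r_i$ contained in $\Omega$ (resp. of radius $r_e$ contained in $\mathbb{R}^N\setminus\overline\Omega$) whose closure meets $\Gamma$ only at $p$. *)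

(* Defs.v *)
From HB Require Import structures.
From mathcomp Require Import all_boot all_order all_algebra.
From mathcomp Require Import all_classical all_reals all_analysis.
Set Implicit Arguments. Unset Strict Implicit. Unset Printing Implicit Defensive.
Import Order.TTheory GRing.Theory Num.Theory.
Import numFieldNormedType.Exports.
Local Open Scope classical_set_scope.
Local Open Scope ring_scope.

Section Defs.
Variables (R : realType) (N : nat).
Notation V := 'rV[R]_N.

(* Euclidean norm (the library's norm on matrices is the sup norm). *)
Definition enorm (x : V) : R := Num.sqrt (\sum_(i < N) x ord0 i ^+ 2).

Definition ebase (i : 'I_N) : V := delta_mx ord0 i.

Definition partial (i : 'I_N) (f : V -> R) (x : V) : R := derive f x (ebase i).

Definition laplacian (f : V -> R) (x : V) : R :=
  \sum_(i < N) partial i (partial i f) x.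

Definition eball (c : V) (r : R) : set V := [set x | enorm (x - c) < r].
Definition ecball (c : V) (r : R) : set V := [set x | enorm (x - c) <= r].

Definition bounded_domain (O : set V) : Prop :=
  open O /\ connected O /\ O !=set0 /\ exists M : R, forall x, O x -> enorm x <= M.

Definition bdry (O : set V) : set V := closure O `\` O.

Definition diameter (O : set V) : R :=
  sup [set d | exists x y, O x /\ O y /\ d = enorm (x - y)].

Definition interior_sphere (O : set V) (r : R) : Prop :=
  forall p, bdry O p -> exists c : V,
    eball c r `<=` O /\ ecball c r `&` bdry O = [set p].

Definition exterior_sphere (O : set V) (r : R) : Prop :=
  forall p, bdry O p -> exists c : V,
    eball c r `<=` ~` closure O /\ ecball c r `&` bdry O = [set p].

(* u in C^1(closure O), with g i the continuous extension to closure O of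
   the i-th partial derivative of u *)
Definition C1_closure (O : set V) (u : V -> R) (g : 'I_N -> V -> R) : Prop :=
  {within closure O, continuous u} /\
  (forall x, O x -> differentiable u x /\ forall i, partial i u x = g i x) /\
  (forall i, {within closure O, continuous (g i)}).

Definition C2_on (O : set V) (u : V -> R) : Prop :=
  (forall x, O x -> differentiable u x) /\
  (forall i x, O x -> differentiable (partial i u) x) /\
  (forall i j, {in O, continuous (partial j (partial i u))}).

Definition cN : R := if N == 2%N then 3 / 2 else N%:R / 2.

End Defs.

(* Main.v *)
Require Import Defs.
From HB Require Import structures.
From mathcomp Require Import all_boot all_order all_algebra.
From mathcomp Require Import all_classical all_reals all_analysis.
From mathcomp Require Import ring lra.
Import Order.TTheory GRing.Theory Num.Theory.
Import numFieldNormedType.Exports.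
Local Open Scope classical_set_scope.
Local Open Scope ring_scope.

(** By the maximum principle [u <= 0] in [O], hence
    [u <= (|x - ci|^2 - ri^2) / 2] in the interior ball [B(ci, ri)] at a
    boundary point [p].  Both sides vanish at [p], so differentiating towards
    [ci] gives [grad u(p) . (p - ci) >= ri^2]: this is the lower bound, and it
    shows that [- grad u(p)] points into the ball.  For the upper bound, [O]
    lies outside the exterior ball [B(ce, re)] and within the distance [d] of
    [p], where [d] is the diameter.  On this region there is a barrier [W <= 0]
    with [W(p) = 0], Laplacian at least [N] and
    [|grad W(p)| <= cN d (d + re) / re].  Differentiating [W <= u] at [p] along
    [- grad u(p)] gives [|grad u(p)|^2 <= |grad W(p)| |grad u(p)|]. *)

Set Implicit Arguments.
Unset Strict Implicit.
Unset Printing Implicit Defensive.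

(** * Euclidean geometry of row vectors *)

Section DotProduct.
Variables (R : comNzRingType) (N : nat).
Implicit Types x y : 'rV[R]_N.

Definition edot x y : R := \sum_(i < N) x ord0 i * y ord0 i.

Lemma edotC x y : edot x y = edot y x.
Proof. by apply: eq_bigr => i _; rewrite mulrC. Qed.

Lemma edot_is_bilinear : bilinear_for *%R *%R edot.
Proof.
have linear_edotl z : GRing.linear_for *%R (edot^~ z).
  move=> a x y; rewrite /edot mulr_sumr -big_split /=.
  by apply: eq_bigr => i _; rewrite !mxE mulrDl mulrA.
by split=> z // a x y; rewrite !(edotC z) linear_edotl.
Qed.

HB.instance Definition _ :=
  bilinear_isBilinear.Build R 'rV[R]_N 'rV[R]_N R *%R *%R edot edot_is_bilinear.

End DotProduct.

Section EuclideanNorm.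
Variables (R : realType) (N : nat).
Local Notation V := 'rV[R]_N.
Implicit Types (x y c : V) (a : R).

Lemma edot_ebase x i : edot x (ebase R i) = x ord0 i.
Proof.
rewrite /edot (bigD1 i)//= big1 ?addr0 => [|j ji].
  by rewrite mxE !eqxx mulr1.
by rewrite mxE (negbTE ji) andbF mulr0.
Qed.

Lemma edot_ge0 x : 0 <= edot x x.
Proof. by apply: sumr_ge0 => i _; rewrite -expr2 sqr_ge0. Qed.

Lemma enorm_ge0 x : 0 <= enorm x.
Proof. exact: sqrtr_ge0. Qed.

Lemma sqr_enorm x : enorm x ^+ 2 = edot x x.
Proof. by rewrite sqr_sqrtr ?edot_ge0. Qed.

Lemma enormZ a x : enorm (a *: x) = `|a| * enorm x.
Proof.
rewrite /enorm; under eq_bigr do rewrite mxE exprMn.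
by rewrite -mulr_sumr sqrtrM ?sqr_ge0// sqrtr_sqr.
Qed.

Lemma enormN x : enorm (- x) = enorm x.
Proof. by rewrite -scaleN1r enormZ normrN1 mul1r. Qed.

Lemma enorm_distC x y : enorm (x - y) = enorm (y - x).
Proof. by rewrite -opprB enormN. Qed.

Lemma ler_coord_enorm x i : `|x ord0 i| <= enorm x.
Proof.
rewrite -sqrtr_sqr; apply: ler_wsqrtr; rewrite (bigD1 i)//= lerDl.
by apply: sumr_ge0 => j _; rewrite sqr_ge0.
Qed.

Lemma enorm0_eq0 x : enorm x = 0 -> x = 0.
Proof.
move=> x0; apply/rowP => i; rewrite mxE; apply/eqP.
by rewrite -normr_le0 -x0 ler_coord_enorm.
Qed.

Lemma ler_edot_enorm x y : edot x y <= enorm x * enorm y.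
Proof.
have [/enorm0_eq0 ->|x0] := eqVneq (enorm x) 0.
  by rewrite linear0l mulr_ge0 ?enorm_ge0.
have [/enorm0_eq0 ->|y0] := eqVneq (enorm y) 0.
  by rewrite linear0r mulr_ge0 ?enorm_ge0.
have xy0 : 0 < 2 * (enorm x * enorm y).
  by rewrite mulr_gt0// mulr_gt0// lt0r ?x0 ?y0 enorm_ge0.
have := edot_ge0 (enorm y *: x - enorm x *: y).
rewrite linearBl !linearBr !linearZl_LR !linearZr_LR /= -!sqr_enorm (edotC y x).
rewrite [leRHS](_ : _ =
    2 * (enorm x * enorm y) * (enorm x * enorm y - edot x y)).
  by rewrite pmulr_rge0// subr_ge0.
by ring.
Qed.

Lemma sqr_enormD x y :
  enorm (x + y) ^+ 2 = enorm x ^+ 2 + 2 * edot x y + enorm y ^+ 2.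
Proof. by rewrite !sqr_enorm linearDl !linearDr /= (edotC y x); ring. Qed.

Lemma ler_enormD x y : enorm (x + y) <= enorm x + enorm y.
Proof.
rewrite -(ler_pXn2r (ltn0Sn 1)) ?nnegrE ?addr_ge0 ?enorm_ge0//.
by rewrite sqr_enormD sqrrD; have := ler_edot_enorm x y; lra.
Qed.

Lemma enorm_continuous : continuous (@enorm R N).
Proof.
move=> x; pose sqr_coord i (y : V) := y ord0 i ^+ 2.
apply: (@continuous_comp _ _ _ (fun y => \sum_i sqr_coord i y) (@Num.sqrt R)).
  apply: (@cvg_big _ _ _ _ _ _ _ (nbhs x) _ sqr_coord) => [|i _].
    exact: add_continuous.
  by apply: cvgM; exact: coord_continuous.
exact: sqrt_continuous.
Qed.

Lemma enorm_sub_continuous c : continuous (fun x => enorm (x - c)).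
Proof.
move=> x; apply: (@continuous_comp _ _ _ (fun x => x - c) (@enorm R N)).
  by apply: continuousB; [move=> ? | exact: cst_continuous].
exact: enorm_continuous.
Qed.

Lemma open_eball c (r : R) : open (eball c r).
Proof.
apply: (@open_comp _ _ (fun x => enorm (x - c)) [set t : R | t < r]).
  by move=> y _; exact: enorm_sub_continuous.
exact: open_lt.
Qed.

Lemma closed_ecball c (r : R) : closed (ecball c r).
Proof.
apply: (@preimage_closed _ _ (fun x => enorm (x - c)) [set t : R | t <= r]).
  by move=> y _; exact: enorm_sub_continuous.
exact: closed_le.
Qed.

Lemma closure_sub_ecball (A : set V) c (r : R) :
  A `<=` ecball c r -> closure A `<=` ecball c r.
Proof.
by move=> /closureS; rewrite -(iffLR (closure_id _) (@closed_ecball c r)).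
Qed.

Definition ebounded (A : set V) : Prop :=
  exists M : R, forall x, A x -> enorm x <= M.

Lemma ebounded_eball c (r : R) : ebounded (eball c r).
Proof.
exists (r + enorm c) => x xc.
rewrite -(subrK c x); apply: le_trans (ler_enormD _ _) _.
by rewrite lerD2r ltW.
Qed.

Lemma ebounded_closure (A : set V) : ebounded A -> ebounded (closure A).
Proof.
move=> [M AM]; exists M => x clAx; rewrite -(subr0 x).
by apply: closure_sub_ecball x clAx => y /AM; rewrite /ecball /= subr0.
Qed.

Lemma compact_closure_ebounded (A : set V) : ebounded A -> compact (closure A).
Proof.
move=> /ebounded_closure[M AM].
apply: bounded_closed_compact; last exact: closed_closure.
exists (Num.max M 0); split; first exact: num_real.
move=> k; rewrite gt_max => /andP[Mk k0] x /AM xM.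
rewrite /= [leLHS]/Num.Def.normr /= mx_normrE.
apply/bigmax_leP; split => [|[i j] _ /=]; first exact: ltW.
by rewrite (ord1 i) (le_trans (ler_coord_enorm _ _))// (le_trans xM)// ltW.
Qed.

Lemma enorm_le_diameter (A : set V) x y :
  ebounded A -> closure A x -> closure A y -> enorm (x - y) <= diameter A.
Proof.
move=> [M AM] clx cly.
have dist_ub : has_ubound [set d | exists x y, A x /\ A y /\ d = enorm (x - y)].
  exists (M + M) => _ [a [b [Aa [Ab ->]]]].
  by rewrite (le_trans (ler_enormD _ _))// enormN lerD// AM.
apply: (closure_sub_ecball _ clx) => a Aa; rewrite /ecball /= enorm_distC.
apply: (closure_sub_ecball _ cly) => b Ab.
by apply: ub_le_sup => //; exists b, a.
Qed.

Lemma diameter_ge0 (A : set V) x : ebounded A -> closure A x -> 0 <= diameter A.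
Proof.
by move=> bA clx; exact: le_trans (enorm_ge0 _) (enorm_le_diameter bA clx clx).
Qed.

End EuclideanNorm.

(** * One-sided and second directional derivatives *)

Section OneSidedDerivative.
Variables (R : realType) (V : normedModType R).
Implicit Types (x v p : V) (f g : V -> R).

Lemma line_continuous v x : continuous (fun t : R => t *: v + x).
Proof.
by move=> t; apply: cvgD; [exact: scalel_continuous|exact: cvg_cst].
Qed.

Lemma near_line (P : set V) v x :
  (\forall z \near x, P z) -> \forall t \near (0 : R), P (t *: v + x).
Proof.
by move=> xP; apply: (@line_continuous v x 0); rewrite scale0r add0r.
Qed.

Lemma near_line_norm (P : set V) v x : (\forall z \near x, P z) ->
  exists2 e : R, 0 < e & forall t, `|t| < e -> P (t *: v + x).
Proof.
move=> /(near_line v)[e /= e0 lineP]; exists e => // t te; apply: lineP.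
by rewrite /= sub0r normrN.
Qed.

Lemma is_derive_lineP f x v (t df : R) :
  is_derive t 1 (fun h => f (h *: v + x)) df <-> is_derive (t *: v + x) v f df.
Proof.
pose y := t *: v + x; pose f_line (h : R) := f (h *: v + x).
have quotientE : (fun h : R => h^-1 *: ((f \o shift y) (h *: v) - f y)) =
    (fun h => h^-1 *: ((f_line \o shift t) (h *: 1) - f_line t)).
  by apply/funext => h /=; rewrite /f_line [_%:A]mulr1 addrA scalerDl.
by split=> -[derivablef derivef]; split;
  [move: derivablef|move: derivef|move: derivablef|move: derivef];
  rewrite /derivable /derive quotientE.
Qed.

Lemma is_derive_line0P f x v (df : R) :
  is_derive (0 : R) 1 (fun h => f (h *: v + x)) df <-> is_derive x v f df.
Proof.
by split=> [/is_derive_lineP|dfx]; [|apply/is_derive_lineP];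
  rewrite scale0r add0r.
Qed.

Lemma is_derive_comp (k : R -> R) f x v (dk df : R) :
  is_derive x v f df -> is_derive (f x) 1 k dk ->
  is_derive x v (k \o f) (dk * df).
Proof.
move=> /is_derive_line0P dfx dkfx; apply/is_derive_line0P.
apply: (@is_derive1_comp _ k (fun h => f (h *: v + x))) => //.
by rewrite scale0r add0r.
Qed.

Definition is_onesided_derive f p v (l : R) : Prop :=
  (f (t *: v + p) - f p) / t @[t --> (0 : R)^'+] --> l.

Lemma is_derive_onesided f p v (l : R) :
  is_derive p v f l -> is_onesided_derive f p v l.
Proof.
move=> [derivablef <-]; rewrite /is_onesided_derive.
under eq_fun do rewrite mulrC; exact: cvg_dnbhs_at_right derivablef.
Qed.

Lemma ler_onesided_derive f g p v (a b : R) :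
  is_onesided_derive f p v a -> is_onesided_derive g p v b -> f p = g p ->
  (\forall t \near (0 : R)^'+, f (t *: v + p) <= g (t *: v + p)) -> a <= b.
Proof.
move=> fa gb fgp fg; apply: ler_cvg_to fa gb _.
near=> t; have t0 : 0 < t by near: t; exact: nbhs_right_gt.
rewrite ler_pM2r ?invr_gt0// fgp lerD2r.
by near: t.
Unshelve. all: by end_near. Qed.

Lemma derive_at_max_eq0 f (f1 : V -> R) v x :
  (\forall z \near x, is_derive z v f (f1 z)) ->
  (\forall z \near x, f z <= f x) -> f1 x = 0.
Proof.
move=> df fmax; have [e e0 lineP] := near_line_norm v (filterI df fmax).
have itvE (t : R) : t \in `]- e, e[ = (`|t| < e) by rewrite in_itv /= ltr_norml.
have [_ <-] := nbhs_singleton df.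
have : is_derive (0 : R) 1 (fun t => f (t *: v + x)) 0.
  apply: (@derive1_at_max _ _ (- e) e); first by lra.
  - by move=> t; rewrite itvE => /lineP[/is_derive_lineP[]].
  - by rewrite itvE normr0.
  - by move=> t; rewrite itvE scale0r add0r => /lineP[].
by move=> /is_derive_line0P[].
Qed.

Lemma cvg_second_difference f (f1 : V -> R) (f2 : R) v x :
  (\forall z \near x, is_derive z v f (f1 z)) -> is_derive x v f1 f2 ->
  f1 x = 0 -> (f (t *: v + x) - f x) / t ^+ 2 @[t --> (0 : R)^'+] --> f2 / 2.
Proof.
move=> df df1 f1x0; have [e e0 lineP] := near_line_norm v df.
pose phi (t : R) := f (t *: v + x).
have phi0 : phi 0 = f x by rewrite /phi scale0r add0r.
have dphi (t : R) : `|t| < e -> is_derive t 1 phi (f1 (t *: v + x)).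
  by move=> /lineP dft; exact/is_derive_lineP.
apply: (lhopital_at_right e0 (f := fun t => phi t - f x)
  (df := fun t => f1 (t *: v + x)) (dg := fun t => 2 * t)).
- move=> t; rewrite in_itv /= => /andP[t0 te].
  have := is_deriveB (dphi t _) (is_derive_cst (f x) t 1).
  by rewrite subr0; apply; rewrite gtr0_norm.
- move=> t _; apply: (is_derive_eq (is_deriveX 2 (is_derive_id t 1))).
  by rewrite [_ *: _]mulr1 expr1 mulr_natl.
- rewrite -phi0 -[X in _ --> X](subrr (phi 0)).
  apply: cvgB; last exact: cvg_cst.
  apply: cvg_at_right_filter.
  apply/differentiable_continuous/derivable1_diffP.
  by have [|+ _] := dphi 0; first by rewrite normr0.
- rewrite -[X in _ --> X](expr0n R 2); apply: cvg_at_right_filter.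
  exact: exprn_continuous.
- by move=> t; rewrite in_itv /= => /andP[t0 _]; rewrite mulf_neq0 ?gt_eqF.
- under eq_fun => t.
    rewrite invfM [2^-1 * _]mulrC mulrA -[f1 _]subr0 -{1}f1x0; over.
  apply: cvgMr_tmp; exact: is_derive_onesided df1.
Qed.

Lemma second_derive_at_max_le0 f (f1 : V -> R) (f2 : R) v x :
  (\forall z \near x, is_derive z v f (f1 z)) -> is_derive x v f1 f2 ->
  (\forall z \near x, f z <= f x) -> f2 <= 0.
Proof.
move=> df df1 fmax; have f1x0 := derive_at_max_eq0 df fmax.
have [e e0 lineP] := near_line_norm v fmax.
suff : f2 / 2 <= 0 by lra.
apply: (ler_cvg_to (cvg_second_difference df df1 f1x0) (cvg_cst 0)).
near=> t; have t0 : 0 < t by near: t; exact: nbhs_right_gt.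
rewrite mulr_le0_ge0 ?invr_ge0 ?exprn_ge0 ?(ltW t0)// subr_le0 lineP//.
by rewrite gtr0_norm//; near: t; exact: nbhs_right_lt.
Unshelve. all: by end_near. Qed.

Definition inward (A : set V) p v : Prop :=
  \forall t \near (0 : R)^'+, A (t *: v + p).

Lemma within_cvg_ray (A : set V) f p v :
  {within A, continuous f} -> A p -> inward A p v ->
  f (t *: v + p) @[t --> (0 : R)^'+] --> f p.
Proof.
move=> /subspace_continuousP cf Ap inA B /(cf p Ap) nearB.
have nearAB : \forall t \near (0 : R)^'+, A (t *: v + p) -> B (f (t *: v + p)).
  by apply: cvg_within; exact: near_line nearB.
by apply: filterS2 nearAB inA => t; apply.
Qed.

End OneSidedDerivative.

(** * Gradients and Laplacians at a point *)

Section GradientLaplacian.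
Variables (R : realType) (N : nat).
Local Notation V := 'rV[R]_N.
Implicit Types (x y v c : V) (a : R) (F : V -> R) (G : V -> V).

Lemma inward_eball c (r : R) p v : 0 < r -> enorm (p - c) = r ->
  edot v (p - c) < 0 -> inward (eball c r) p v.
Proof.
move=> r0 pc; set a := edot v (p - c) => a_lt0.
have v0 : 0 < enorm v ^+ 2 + 1 by rewrite ltr_wpDl ?sqr_ge0.
have bound_gt0 : 0 < - a * 2 / (enorm v ^+ 2 + 1) by rewrite divr_gt0//; lra.
near=> t; have t0 : 0 < t by near: t; exact: nbhs_right_gt.
have t_small : t * (enorm v ^+ 2 + 1) < - a * 2.
  by rewrite -ltr_pdivlMr//; near: t; exact: nbhs_right_lt.
rewrite /eball /= -addrA -(ltr_pXn2r (ltn0Sn 1)) ?nnegrE ?enorm_ge0 ?ltW//.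
rewrite sqr_enormD pc linearZl_LR /= -/a enormZ gtr0_norm// exprMn.
have : t * (t * (enorm v ^+ 2 + 1)) < t * (- a * 2) by rewrite ltr_pM2l.
have : 0 < t * t by rewrite mulr_gt0.
lra.
Unshelve. all: by end_near. Qed.

Lemma is_derive1_inv (r : R) : r != 0 ->
  is_derive r 1 (fun t : R => t^-1) (- r ^- 2).
Proof.
move=> r0; apply: (is_derive_eq (@is_deriveV _ id r 1 1 r0 _)).
by rewrite [LHS]mulr1.
Qed.

Lemma is_derive_edot x v y c :
  is_derive x v (fun z => edot (z - c) y) (edot v y).
Proof.
apply/is_derive_line0P.
have -> : (fun t => edot (t *: v + x - c) y) =
    (edot v y \*: (@idfun R)) + cst (edot (x - c) y).
  by apply/funext => t; rewrite -(addrA (t *: v)) linearDl linearZl_LR /= mulrC.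
by apply: is_derive_eq; rewrite addr0 [_%:A]mulr1.
Qed.

Lemma is_derive_coord_sub c x v i :
  is_derive x v (fun y => (y - c) ord0 i) (v ord0 i).
Proof.
under eq_fun do rewrite -edot_ebase.
by rewrite -(edot_ebase v); exact: is_derive_edot.
Qed.

Lemma is_derive_sqr_enorm x v c :
  is_derive x v (fun z => enorm (z - c) ^+ 2) (2 * edot (x - c) v).
Proof.
have -> : (fun z => enorm (z - c) ^+ 2) =
    (\sum_(i < N) (fun z => (z - c) ord0 i) ^+ 2).
  apply/funext => z; rewrite sqr_enorm fct_sumE.
  by apply: eq_bigr => i _; rewrite exprfctE expr2.
apply: is_derive_eq.
  apply: is_derive_sum => i; exact: is_deriveX (is_derive_coord_sub c x v i).
rewrite mulr_sumr; apply: eq_bigr => i _.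
by rewrite /GRing.scale /= expr1; ring.
Qed.

Lemma is_derive_enorm x v c : 0 < enorm (x - c) ->
  is_derive x v (fun z => enorm (z - c)) (edot (x - c) v / enorm (x - c)).
Proof.
move=> r0.
have -> : (fun z => enorm (z - c)) = Num.sqrt \o (fun z => enorm (z - c) ^+ 2).
  by apply/funext => z /=; rewrite sqrtr_sqr ger0_norm// enorm_ge0.
apply: is_derive_eq.
  apply: is_derive_comp (is_derive_sqr_enorm x v c) _.
  by apply: is_derive1_sqrt; rewrite exprn_gt0.
rewrite sqrtr_sqr ger0_norm ?enorm_ge0//=.
by field; rewrite gt_eqF.
Qed.

(* [G] plays the role of the gradient field of [F] and [L] that of the
   Laplacian, i.e. the divergence of [G], at the single point [x]. *)
Definition is_grad_lap F G (L : R) x : Prop :=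
  [/\ {for x, continuous F}, forall v, is_derive x v F (edot (G x) v) &
    exists D : 'I_N -> R,
      (forall i, is_derive x (ebase R i) (fun y => G y ord0 i) (D i)) /\
      \sum_i D i = L].

Lemma is_grad_lap_cst a x : is_grad_lap (cst a) (cst 0) 0 x.
Proof.
split; first exact: cst_continuous.
  by move=> v; rewrite linear0l; exact: is_derive_cst.
exists (fun=> 0); split; last by rewrite big1.
by move=> i; under eq_fun do rewrite mxE; exact: is_derive_cst.
Qed.

Lemma is_grad_lapD F1 G1 L1 F2 G2 L2 x :
  is_grad_lap F1 G1 L1 x -> is_grad_lap F2 G2 L2 x ->
  is_grad_lap (fun y => F1 y + F2 y) (fun y => G1 y + G2 y) (L1 + L2) x.
Proof.
move=> [c1 d1 [D1 [dG1 <-]]] [c2 d2 [D2 [dG2 <-]]]; split.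
- exact: continuousD.
- by move=> v; rewrite linearDl; exact: is_deriveD (d1 v) (d2 v).
- exists (fun i => D1 i + D2 i); split; last by rewrite big_split.
  by move=> i; under eq_fun do rewrite mxE; exact: is_deriveD (dG1 i) (dG2 i).
Qed.

Lemma is_grad_lapM F1 G1 L1 F2 G2 L2 x :
  is_grad_lap F1 G1 L1 x -> is_grad_lap F2 G2 L2 x ->
  is_grad_lap (fun y => F1 y * F2 y) (fun y => F1 y *: G2 y + F2 y *: G1 y)
    (F1 x * L2 + F2 x * L1 + 2 * edot (G1 x) (G2 x)) x.
Proof.
move=> [c1 d1 [D1 [dG1 <-]]] [c2 d2 [D2 [dG2 <-]]]; split.
- exact: continuousM.
- by move=> v; rewrite linearDl !linearZl_LR; exact: is_deriveM (d1 v) (d2 v).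
- exists (fun i => F1 x * D2 i + F2 x * D1 i + 2 * (G1 x ord0 i * G2 x ord0 i)).
  split; last by rewrite !big_split /= -!mulr_sumr.
  move=> i; under eq_fun do rewrite !mxE.
  have dF1 := d1 (ebase R i); have dF2 := d2 (ebase R i).
  apply: (is_derive_eq
    (is_deriveD (is_deriveM dF1 (dG2 i)) (is_deriveM dF2 (dG1 i)))).
  by rewrite !edot_ebase /GRing.scale /=; ring.
Qed.

Lemma is_grad_lapZ F G L a x :
  is_grad_lap F G L x ->
  is_grad_lap (fun y => a * F y) (fun y => a *: G y) (a * L) x.
Proof.
move=> /(is_grad_lapM (is_grad_lap_cst a x)).
rewrite mulr0 linear0l mulr0 !addr0.
by under [X in is_grad_lap _ X]eq_fun do rewrite scaler0 addr0.
Qed.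

Lemma is_grad_lapB F1 G1 L1 F2 G2 L2 x :
  is_grad_lap F1 G1 L1 x -> is_grad_lap F2 G2 L2 x ->
  is_grad_lap (fun y => F1 y - F2 y) (fun y => G1 y - G2 y) (L1 - L2) x.
Proof.
move=> gl1 /(is_grad_lapZ (-1))/(is_grad_lapD gl1); rewrite mulN1r.
under eq_fun do rewrite mulN1r.
by under [X in is_grad_lap _ X]eq_fun do rewrite scaleN1r.
Qed.

Lemma is_grad_lap_within_continuous (A : set V) F G (L : V -> R) :
  (forall x, A x -> is_grad_lap F G (L x) x) -> {within A, continuous F}.
Proof.
move=> FGL; apply/subspace_continuousP => x Ax.
by apply: cvg_within_filter; have [] := FGL x Ax.
Qed.

Definition paraboloid c (r : R) x : R := (enorm (x - c) ^+ 2 - r ^+ 2) / 2.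

Lemma is_grad_lap_paraboloid c (r : R) x :
  is_grad_lap (paraboloid c r) (fun y => y - c) N%:R x.
Proof.
split.
- apply: continuousM; last exact: cst_continuous.
  apply: continuousB; last exact: cst_continuous.
  by apply: continuousM; exact: enorm_sub_continuous.
- move=> v; have -> : paraboloid c r =
      2^-1 \*: ((fun y => enorm (y - c) ^+ 2) - cst (r ^+ 2)).
    by apply/funext => y; rewrite /paraboloid mulrC.
  apply: is_derive_eq.
    apply/is_deriveZ/is_deriveB; exact: is_derive_sqr_enorm.
  by rewrite subr0 [LHS]mulKf.
- exists (fun=> 1); split; last by rewrite sumr_const card_ord.
  move=> i; apply: is_derive_eq (is_derive_coord_sub c x (ebase R i) i) _.
  by rewrite mxE !eqxx.
Qed.

Lemma paraboloid_center c (r : R) : paraboloid c r c = - (r ^+ 2 / 2).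
Proof.
rewrite /paraboloid subrr -(scale0r 0) enormZ normr0 mul0r expr0n.
by rewrite sub0r mulNr.
Qed.

Lemma paraboloid_sphere c (r : R) x : enorm (x - c) = r -> paraboloid c r x = 0.
Proof. by move=> xc; rewrite /paraboloid xc subrr mul0r. Qed.

Lemma paraboloid_le0 c (r : R) x : enorm (x - c) <= r -> paraboloid c r x <= 0.
Proof.
move=> xr; rewrite mulr_le0_ge0// subr_le0.
by rewrite lerXn2r ?nnegrE ?enorm_ge0// (le_trans (enorm_ge0 _) xr).
Qed.

Lemma paraboloid_ge0 c (r : R) x : 0 <= r -> r <= enorm (x - c) ->
  0 <= paraboloid c r x.
Proof.
by move=> r0 xr; rewrite divr_ge0// subr_ge0 lerXn2r ?nnegrE ?enorm_ge0.
Qed.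

Lemma is_grad_lap_radial (phi phi1 : R -> R) (phi2 : R) c x :
  let r := enorm (x - c) in
  0 < r -> is_derive r 1 phi (phi1 r) -> is_derive r 1 phi1 phi2 ->
  is_grad_lap (fun y => phi (enorm (y - c)))
    (fun y => (phi1 (enorm (y - c)) / enorm (y - c)) *: (y - c))
    (phi2 + (N%:R - 1) * (phi1 r / r)) x.
Proof.
move=> r r0 dphi dphi1; have r_neq0 : r != 0 by rewrite gt_eqF.
split.
- apply: (@continuous_comp _ _ _ (fun y => enorm (y - c)) phi).
    exact: enorm_sub_continuous.
  by apply/differentiable_continuous/derivable1_diffP; case: dphi.
- move=> v; rewrite linearZl_LR /= mulrAC -mulrA.
  exact: is_derive_comp (is_derive_enorm v r0) dphi.
- pose h i := (x - c) ord0 i.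
  exists (fun i => (phi2 - phi1 r / r) / r ^+ 2 * h i ^+ 2 + phi1 r / r); split.
    move=> i; under eq_fun do rewrite mxE.
    have dquotient := is_derive_comp (is_derive_enorm (ebase R i) r0)
      (is_deriveM dphi1 (is_derive1_inv r_neq0)).
    apply: (is_derive_eq
      (is_deriveM dquotient (is_derive_coord_sub c x (ebase R i) i))).
    rewrite mxE !eqxx edot_ebase /GRing.scale /= -/r -/(h i).
    by rewrite -[(phi1 * _) r]/(phi1 r / r); field.
  rewrite big_split /= -mulr_sumr sumr_const card_ord.
  have -> : \sum_i h i ^+ 2 = r ^+ 2 by rewrite sqr_enorm; apply: eq_bigr.
  by rewrite -mulr_natr; field.
Qed.

Lemma is_derive_gradient (u : V -> R) x v : differentiable u x ->
  is_derive x v u (edot (\row_i partial i u x) v).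
Proof.
move=> dux; split; first exact: diff_derivable.
rewrite deriveE// [in LHS](row_sum_delta v) linear_sum.
by apply: eq_bigr => i _; rewrite linearZ /= -deriveE// [RHS]mulrC mxE.
Qed.

Lemma C2_on_is_grad_lap (O : set V) (u : V -> R) x : C2_on O u -> O x ->
  is_grad_lap u (fun y => \row_i partial i u y) (laplacian u x) x.
Proof.
move=> [du [d2u _]] Ox; split.
- exact/differentiable_continuous/du.
- by move=> v; exact/is_derive_gradient/du.
- exists (fun i => partial i (partial i u) x); split=> // i.
  under eq_fun do rewrite mxE.
  by split; [exact/diff_derivable/d2u|].
Qed.

Lemma C1_closure_onesided_derive (O : set V) (u : V -> R)
    (g : 'I_N -> V -> R) p v :
  C1_closure O u g -> closure O p -> inward O p v ->
  is_onesided_derive u p v (edot (\row_i g i p) v).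
Proof.
move=> [cu [du cg]] clp inO; have [e /= e0 lineO] := inO.
have {}lineO (t : R) : t \in `]0, e[ -> O (t *: v + p).
  rewrite in_itv /= => /andP[t0 te]; apply: lineO => //=.
  by rewrite sub0r normrN gtr0_norm.
have inclO : inward (closure O) p v.
  by apply: filterS inO => t; exact: subset_closure.
pose du_line (t : R) := edot (\row_i g i (t *: v + p)) v.
rewrite /is_onesided_derive.
apply: (lhopital_at_right e0 (df := du_line) (dg := fun=> 1)).
- move=> t /lineO Ot; have [dut gE] := du _ Ot.
  have -> : du_line t = edot (\row_i partial i u (t *: v + p)) v.
    by congr edot; apply/rowP => i; rewrite !mxE gE.
  have := is_deriveB ((is_derive_lineP u p v t _).2 (is_derive_gradient v dut))
    (is_derive_cst (u p) t 1).
  by rewrite subr0.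
- rewrite -[X in _ --> X](subrr (u p)).
  by apply: cvgB; [exact: within_cvg_ray|exact: cvg_cst].
- by apply: cvg_at_right_filter; exact: cvg_id.
- by move=> t _; exact: oner_neq0.
- under eq_fun do rewrite divr1.
  apply: cvg_big => [|i _]; first exact: add_continuous.
  apply: cvgM; last exact: cvg_cst.
  rewrite mxE; under eq_fun do rewrite mxE.
  exact: within_cvg_ray.
Qed.

End GradientLaplacian.

(** * Maximum principle *)

Section MaximumPrinciple.
Variables (R : realType) (N : nat) (O : set 'rV[R]_N).
Local Notation V := 'rV[R]_N.
Implicit Types (x y : V) (F : V -> R) (G : V -> V) (L : V -> R).

Lemma local_max_laplacian_le0 F G L x :
  (\forall z \near x, is_grad_lap F G (L z) z) ->
  (\forall z \near x, F z <= F x) -> L x <= 0.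
Proof.
move=> FGL Fmax; have [_ _ [D [dG <-]]] := nbhs_singleton FGL.
apply: sumr_le0 => i _.
apply: (second_derive_at_max_le0 (f1 := fun z => G z ord0 i) _ (dG i) Fmax).
by apply: filterS FGL => z [_ + _] => /(_ (ebase R i)); rewrite edot_ebase.
Qed.

Lemma strict_maximum_principle F G L (m : R) :
  open O -> compact (closure O) -> {within closure O, continuous F} ->
  (forall x, O x -> is_grad_lap F G (L x) x) -> (forall x, O x -> 0 < L x) ->
  (forall x, bdry O x -> F x <= m) -> forall x, closure O x -> F x <= m.
Proof.
move=> oO cO cF FGL L0 Fm x clx.
have [|y] := EVT_max_rV _ cO cF; first by exists x.
rewrite inE => cly ymax.
have {}ymax z : closure O z -> F z <= F y.
  by move=> clz; apply: ymax; rewrite inE.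
apply: le_trans (ymax _ clx) _.
have [Oy|nOy] := pselect (O y); last by apply: Fm.
have nearO : \forall z \near y, O z by exact: open_nbhs_nbhs.
have : L y <= 0.
  apply: (@local_max_laplacian_le0 F G); apply: filterS nearO => z Oz.
    exact: FGL.
  exact/ymax/subset_closure.
by rewrite leNgt L0.
Qed.

(* The Laplacian of the difference becomes positive when [(|x|^2 - M^2) / 2] is
   added with a small factor. *)
Lemma comparison_principle F1 G1 L1 F2 G2 L2 :
  (0 < N)%N -> open O -> ebounded O ->
  {within closure O, continuous F1} -> {within closure O, continuous F2} ->
  (forall x, O x -> is_grad_lap F1 G1 (L1 x) x) ->
  (forall x, O x -> is_grad_lap F2 G2 (L2 x) x) ->
  (forall x, O x -> L2 x <= L1 x) ->
  (forall x, bdry O x -> F1 x <= F2 x) -> forall x, closure O x -> F1 x <= F2 x.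
Proof.
move=> N0 oO bO cF1 cF2 gl1 gl2 L21 F12 x clx.
have [M clM] := ebounded_closure bO.
have par_le0 y : closure O y -> paraboloid 0 M y <= 0.
  by move=> /clM yM; apply: paraboloid_le0; rewrite subr0.
pose a := - paraboloid 0 M x.
have a0 : 0 <= a by rewrite oppr_ge0 par_le0.
apply/ler_addgt0Pr => e e0; pose d : R := e / (a + 1).
have a1 : 0 < a + 1 by lra.
have d0 : 0 < d by rewrite divr_gt0.
have da : d * a <= e by rewrite mulrAC ler_pdivrMr// ler_pM2l//; lra.
pose F y := (F1 y - F2 y) + d * paraboloid 0 M y.
have gld y := is_grad_lapZ d (is_grad_lap_paraboloid 0 M y).
suff : F x <= 0 by rewrite /F -[paraboloid _ _ _]opprK mulrN -/a; lra.
apply: (strict_maximum_principle oO (compact_closure_ebounded bO) _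
  (fun y Oy =>
    is_grad_lapD (is_grad_lapB (gl1 y Oy) (gl2 y Oy)) (gld y))) => //.
- apply: within_continuousD; first exact: within_continuousB.
  by apply: is_grad_lap_within_continuous => y _; exact: gld.
- move=> y Oy; have := L21 y Oy.
  by have : 0 < d * N%:R by [rewrite mulr_gt0// ltr0n]; lra.
- move=> y bdy; have := F12 y bdy; have [cly _] := bdy.
  have : d * paraboloid 0 M y <= 0 by rewrite mulr_ge0_le0 ?par_le0// ltW.
  by rewrite /F; lra.
Qed.

End MaximumPrinciple.

(** * Boundary gradient of the torsion function *)

Section BarrierDefinition.
Variables (R : realType) (N : nat).
Local Notation V := 'rV[R]_N.
Implicit Types (A : set V) (p : V) (K : R).

Definition torsion_subsolution A (W : V -> R) (G : V -> V) (L : V -> R) :=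
  forall x, A x -> [/\ is_grad_lap W G (L x) x, N%:R <= L x & W x <= 0].

Definition has_barrier A p K : Prop :=
  exists W G L, [/\ W p = 0, enorm (G p) <= K & torsion_subsolution A W G L].

Lemma has_barrier_le A p K K' :
  K <= K' -> has_barrier A p K -> has_barrier A p K'.
Proof.
move=> KK' [W [G [L [Wp GpK subW]]]].
by exists W, G, L; split => //; exact: le_trans KK'.
Qed.

Definition interior_tangent_ball (O : set V) c (r : R) p : Prop :=
  [/\ 0 < r, eball c r `<=` O, bdry O p & enorm (p - c) = r].

End BarrierDefinition.

Section TorsionProblem.
Variables (R : realType) (N : nat) (O : set 'rV[R]_N).
Variables (u : 'rV[R]_N -> R) (g : 'I_N -> 'rV[R]_N -> R).
Local Notation V := 'rV[R]_N.
Local Notation gradu p := (\row_i g i p).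
Implicit Types (x y v c p : V).

Hypothesis N_gt0 : (0 < N)%N.
Hypothesis openO : open O.
Hypothesis boundedO : ebounded O.
Hypothesis C1u : C1_closure O u g.
Hypothesis C2u : C2_on O u.
Hypothesis laplacian_u : forall x, O x -> laplacian u x = N%:R.
Hypothesis u_bdry : forall x, bdry O x -> u x = 0.

Lemma torsion_le0 x : closure O x -> u x <= 0.
Proof.
apply: (comparison_principle N_gt0 openO boundedO (F2 := cst 0) (proj1 C1u) _
  (fun y => C2_on_is_grad_lap C2u) (fun y _ => is_grad_lap_cst 0 y)).
- by apply: continuous_subspaceT; exact: cst_continuous.
- by move=> y Oy; rewrite laplacian_u.
- by move=> y /u_bdry ->.
Qed.

Lemma torsion_le_paraboloid c (r : R) x : 0 < r -> eball c r `<=` O ->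
  eball c r x -> u x <= paraboloid c r x.
Proof.
move=> r0 ballO /subset_closure; move: x.
have clballO : closure (eball c r) `<=` closure O by exact: closureS.
apply: (comparison_principle N_gt0 (@open_eball _ _ c r)
  (@ebounded_eball _ _ c r) (continuous_subspaceW clballO (proj1 C1u)) _
  (fun y => C2_on_is_grad_lap C2u \o ballO y)
  (fun y _ => is_grad_lap_paraboloid c r y)).
- by apply: is_grad_lap_within_continuous => y _; exact: is_grad_lap_paraboloid.
- by move=> y /ballO Oy; rewrite laplacian_u.
- move=> y [cly /negP]; rewrite -leNgt => ry.
  exact: le_trans (torsion_le0 (clballO _ cly)) (paraboloid_ge0 (ltW r0) ry).
Qed.

Lemma edot_gradient_ge_sqr_radius c (r : R) p :
  interior_tangent_ball O c r p -> r ^+ 2 <= edot (gradu p) (p - c).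
Proof.
move=> [r0 ballO bp pc].
have cp : edot (c - p) (p - c) < 0.
  by rewrite -opprB linearNl /= -sqr_enorm pc oppr_lt0 exprn_gt0.
have inball := inward_eball r0 pc cp.
have inO : inward O p (c - p) by apply: filterS inball => t /ballO.
have [_ dpar _] := is_grad_lap_paraboloid c r p.
rewrite -pc sqr_enorm -lerN2 -!linearNr opprB /=.
apply: (ler_onesided_derive (C1_closure_onesided_derive C1u _ inO)
  (is_derive_onesided (dpar _))).
- by case: bp.
- by rewrite u_bdry// paraboloid_sphere.
- by apply: filterS inball => t; exact: torsion_le_paraboloid.
Qed.

Lemma enorm_gradient_ge_radius c (r : R) p :
  interior_tangent_ball O c r p -> r <= enorm (gradu p).
Proof.
move=> ball_p; have [r0 _ _ pc] := ball_p.
have := le_trans (edot_gradient_ge_sqr_radius ball_p) (ler_edot_enorm _ _).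
by rewrite pc expr2 ler_pM2r.
Qed.

Lemma inward_opp_gradient c (r : R) p :
  interior_tangent_ball O c r p -> inward O p (- gradu p).
Proof.
move=> ball_p; have [r0 ballO _ pc] := ball_p.
have gradu_pc : edot (- gradu p) (p - c) < 0.
  rewrite linearNl /= oppr_lt0.
  by apply: lt_le_trans (edot_gradient_ge_sqr_radius ball_p); rewrite exprn_gt0.
by apply: filterS (inward_eball r0 pc gradu_pc) => t /ballO.
Qed.

Lemma subsolution_le_torsion (A : set V) W G L :
  closure O `<=` A -> torsion_subsolution A W G L ->
  forall x, closure O x -> W x <= u x.
Proof.
move=> clOA subW.
have glW x : closure O x -> is_grad_lap W G (L x) x by move=> /clOA/subW[].
apply: (comparison_principle N_gt0 openO boundedO
  (is_grad_lap_within_continuous glW) (proj1 C1u)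
  (fun y Oy => glW y (subset_closure Oy)) (fun y => C2_on_is_grad_lap C2u)).
- move=> y Oy; rewrite laplacian_u//.
  by case: (subW y (clOA y (subset_closure Oy))).
- by move=> y bdy; rewrite u_bdry//; case: bdy => /clOA/subW[].
Qed.

Lemma enorm_gradient_le_barrier (A : set V) (K : R) c (r : R) p :
  interior_tangent_ball O c r p -> closure O `<=` A -> has_barrier A p K ->
  enorm (gradu p) <= K.
Proof.
move=> ball_p clOA [W [G [L [Wp GpK subW]]]]; have [r0 _ bp _] := ball_p.
have [clp _] := bp; have inO := inward_opp_gradient ball_p.
have [[_ dW _] _ _] := subW p (clOA p clp).
have : edot (G p) (- gradu p) <= edot (gradu p) (- gradu p).
  apply: (ler_onesided_derive (is_derive_onesided (dW _))
    (C1_closure_onesided_derive C1u clp inO)); first by rewrite u_bdry.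
  apply: filterS inO => t Ot.
  exact: (subsolution_le_torsion clOA subW) (subset_closure Ot).
rewrite !linearNr /= lerN2 -sqr_enorm => sqr_gradu.
have gradu0 : 0 < enorm (gradu p).
  exact: lt_le_trans (enorm_gradient_ge_radius ball_p).
rewrite -(ler_pM2r gradu0) -expr2 (le_trans sqr_gradu)//.
by rewrite (le_trans (ler_edot_enorm _ _))// ler_pM2r.
Qed.

End TorsionProblem.

(** * Barriers outside a ball *)

Lemma pow_tangent_le1 (R : realDomainType) (s : R) (m : nat) : 0 <= s ->
  s ^+ m * (m.+1%:R - m%:R * s) <= 1.
Proof.
move=> s0; elim: m => [|m]; first by rewrite expr0 mul0r subr0 mul1r.
apply: le_trans; rewrite -subr_ge0 exprSr -!natr1.
rewrite [leRHS](_ : _ = s ^+ m * (m%:R + 1) * (1 - s) ^+ 2); last by ring.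
by rewrite mulr_ge0 ?sqr_ge0// mulr_ge0 ?exprn_ge0// natr1.
Qed.

(* Divided by [1 - s], this is the trapezoid rule
   [2 (s + ... + s ^ n) <= n (1 + s ^ n.+1)] for a convex sequence. *)
Lemma pow_trapezoid_ge0 (R : realDomainType) (s : R) (n : nat) : 0 <= s <= 1 ->
  0 <= n%:R - n.+2%:R * s + n.+2%:R * s ^+ n.+1 - n%:R * s ^+ n.+2.
Proof.
move=> /andP[s0 s1]; elim: n => [|n IHn]; first by rewrite expr1; lra.
have increment_ge0 : 0 <= (1 - s) * (1 - s ^+ n.+1 * (n.+2%:R - n.+1%:R * s)).
  by rewrite mulr_ge0 ?subr_ge0 ?pow_tangent_le1.
rewrite [leRHS](_ : _ =
  (n%:R - n.+2%:R * s + n.+2%:R * s ^+ n.+1 - n%:R * s ^+ n.+2)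
  + (1 - s) * (1 - s ^+ n.+1 * (n.+2%:R - n.+1%:R * s))).
  exact: addr_ge0.
by rewrite !exprSr -!natr1; ring.
Qed.

Lemma pow_mean_le (R : realFieldType) (s e : R) (n : nat) :
  (0 < n)%N -> 0 < s <= 1 -> 1 <= s * (1 + e) ->
  (1 - s ^+ n) / n%:R <= (1 + e / 2) * ((1 - s ^+ n.+1) / n.+1%:R).
Proof.
move=> n0 /andP[s0 s1] se.
have n_gt0 : 0 < n%:R :> R by rewrite ltr0n.
have pow_le1 : 0 <= 1 - s ^+ n.+1 by rewrite subr_ge0 exprn_ile1 ?(ltW s0).
rewrite mulrA ler_pdivlMr// mulrAC ler_pdivrMr//.
have s2 : 0 < 2 * s by rewrite mulr_gt0.
rewrite -(ler_pM2l s2) -subr_ge0.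
rewrite [leRHS](_ : _ =
  (n%:R - n.+2%:R * s + n.+2%:R * s ^+ n.+1 - n%:R * s ^+ n.+2)
  + (s * (1 + e) - 1) * (1 - s ^+ n.+1) * n%:R).
  rewrite addr_ge0 ?pow_trapezoid_ge0 ?(ltW s0)//.
  by rewrite !mulr_ge0 ?subr_ge0 ?(ltW n_gt0)// -subr_ge0.
by rewrite !exprSr -!natr1; field.
Qed.

Section ShellPotential.
Variables (R : realType) (N : nat) (rho : R) (c : 'rV[R]_N).
Local Notation V := 'rV[R]_N.
Implicit Types x : V.

Definition shell_ratio x : R := rho / enorm (x - c).

Definition shell_potential (k : nat) x : R := 1 - shell_ratio x ^+ k.

Definition shell_gradient (k : nat) x : V :=
  (k%:R * shell_ratio x ^+ k / enorm (x - c) ^+ 2) *: (x - c).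

Definition shell_laplacian (k : nat) x : R :=
  k%:R * (N%:R - k%:R - 2) * shell_ratio x ^+ k / enorm (x - c) ^+ 2.

Lemma is_derive_ratio_pow (k : nat) (r : R) : r != 0 ->
  is_derive r 1 (fun t => (rho / t) ^+ k) (- (k%:R * (rho / r) ^+ k / r)).
Proof.
move=> r0.
have -> : (fun t => (rho / t) ^+ k) = (rho \*: (fun t : R => t^-1)) ^+ k.
  by apply/funext => t; rewrite exprfctE.
apply: is_derive_eq.
  by apply/is_deriveX/is_deriveZ/is_derive1_inv.
rewrite /GRing.scale /=.
case: k => [|k /=]; first by rewrite !(mul0r, oppr0).
rewrite (exprSr (rho / r)) -[_ *: _]/(rho / r).
by move: (_ ^+ k) => rk; field.
Qed.

Lemma is_grad_lap_shell_potential k x : 0 < enorm (x - c) ->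
  is_grad_lap (shell_potential k) (shell_gradient k) (shell_laplacian k x) x.
Proof.
move=> r0; set r := enorm (x - c) in r0.
have r_neq0 : r != 0 by rewrite gt_eqF.
pose phi (t : R) : R := 1 - (rho / t) ^+ k.
pose phi1 (t : R) : R := k%:R * (rho / t) ^+ k / t.
have dpow := is_derive_ratio_pow k r_neq0.
have dphi : is_derive r 1 phi (phi1 r).
  have := is_deriveB (is_derive_cst (1 : R) r (1 : R)) dpow.
  by rewrite sub0r opprK.
pose phi2 := - (k%:R * (k%:R + 1) * (rho / r) ^+ k / r ^+ 2).
have dphi1 : is_derive r 1 phi1 phi2.
  apply: (is_derive_eq
    (is_deriveM (is_deriveZ k%:R dpow) (is_derive1_inv r_neq0))).
  rewrite -[(_ \*: _) r]/(k%:R * (rho / r) ^+ k) /phi2 /GRing.scale /=.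
  by field.
have := is_grad_lap_radial r0 dphi dphi1.
have -> : phi2 + (N%:R - 1) * (phi1 r / r) = shell_laplacian k x.
  by rewrite /shell_laplacian /shell_ratio -/r /phi2 /phi1; field.
rewrite [X in is_grad_lap _ X](_ : _ = shell_gradient k)//.
apply/funext => y; rewrite /shell_gradient /shell_ratio /phi1.
by rewrite expr2 invfM mulrA.
Qed.

End ShellPotential.

Section ShellPotentialOutside.
Variables (R : realType) (N : nat) (rho : R) (c : 'rV[R]_N).
Local Notation V := 'rV[R]_N.
Local Notation s := (shell_ratio rho c).
Local Notation P := (shell_potential rho c).
Implicit Types x p : V.
Hypothesis rho_gt0 : 0 < rho.

Lemma shell_ratio_sphere p : enorm (p - c) = rho -> s p = 1.
Proof. by rewrite /shell_ratio => ->; rewrite divff// gt_eqF. Qed.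

Lemma shell_potential_sphere k p : enorm (p - c) = rho -> P k p = 0.
Proof.
by move=> pc; rewrite /shell_potential shell_ratio_sphere// expr1n subrr.
Qed.

Lemma shell_gradient_sphere k p : enorm (p - c) = rho ->
  shell_gradient rho c k p = (k%:R / rho ^+ 2) *: (p - c).
Proof.
by move=> pc; rewrite /shell_gradient shell_ratio_sphere// expr1n mulr1 pc.
Qed.

Lemma shell_ratio_itv x : rho <= enorm (x - c) -> 0 < s x <= 1.
Proof.
move=> xc; have x0 := lt_le_trans rho_gt0 xc.
by rewrite divr_gt0//= ler_pdivrMr// mul1r.
Qed.

Lemma shell_potential_ge0 k x : rho <= enorm (x - c) -> 0 <= P k x.
Proof.
by move=> /shell_ratio_itv/andP[s0 s1]; rewrite subr_ge0 exprn_ile1// ltW.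
Qed.

Lemma shell_laplacian_le0 k x : (N <= k + 2)%N -> rho <= enorm (x - c) ->
  shell_laplacian rho c k x <= 0.
Proof.
move=> Nk /shell_ratio_itv/andP[s0 _].
rewrite /shell_laplacian -!mulrA mulr_ge0_le0// mulr_le0_ge0//.
  by rewrite -addrA -opprD subr_le0 -natrD ler_nat.
by rewrite mulr_ge0 ?invr_ge0 ?sqr_ge0// exprn_ge0// ltW.
Qed.

End ShellPotentialOutside.

Definition exterior_cap (R : realType) (N : nat) (d re : R) (c p : 'rV[R]_N) :
  set 'rV[R]_N := ecball p d `\` eball c re.

Section Barriers.
Variables (R : realType) (N : nat) (d re : R) (c p : 'rV[R]_N).
Local Notation V := 'rV[R]_N.
Local Notation s := (shell_ratio re c).
Local Notation P := (shell_potential re c).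
Local Notation cap := (exterior_cap d re c p).
Implicit Types x : V.

Hypothesis d_ge0 : 0 <= d.
Hypothesis re_gt0 : 0 < re.
Hypothesis pc : enorm (p - c) = re.

Let re_neq0 : re != 0. Proof. by rewrite gt_eqF. Qed.

Lemma cap_enorm_ge x : cap x -> re <= enorm (x - c).
Proof. by move=> [_ /negP]; rewrite -leNgt. Qed.

Lemma cap_enorm_gt0 x : cap x -> 0 < enorm (x - c).
Proof. by move=> /cap_enorm_ge; exact: lt_le_trans. Qed.

Lemma cap_enorm_le x : cap x -> enorm (x - c) <= re + d.
Proof.
move=> [xp _]; rewrite -(subrKA p) addrC.
apply: le_trans (ler_enormD _ _) _; rewrite pc lerD2l; exact: xp.
Qed.

Lemma cap_edot_ge0 x : cap x -> 0 <= edot (x - p) (x - c).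
Proof.
move=> /cap_enorm_ge xc.
have -> : x - p = (x - c) - (p - c) by rewrite opprB addrA subrK.
rewrite linearBl /= -sqr_enorm subr_ge0 (le_trans (ler_edot_enorm _ _))//.
by rewrite pc expr2 ler_wpM2r ?enorm_ge0.
Qed.

Lemma enorm_cap_gradient_le (a K : R) :
  a = - (K / re) -> 0 <= K -> enorm (a *: (p - c)) <= K.
Proof.
move=> -> K0; rewrite enormZ pc normrN ger0_norm ?divfK//.
by rewrite divr_ge0// ltW.
Qed.

(* [C] is such that the barrier vanishes on both spheres [|x - c| = re] and
   [|x - c| = re + d]. *)
Lemma has_barrier_cap_low_dim : (N <= 3)%N ->
  has_barrier cap p (d * (d + 3 * re) / (2 * re)).
Proof.
move=> N3; pose C := (re + d) * (re + d + re) / 2.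
have C_ge0 : 0 <= C by rewrite divr_ge0 ?mulr_ge0 ?addr_ge0 ?(ltW re_gt0).
exists (fun x => paraboloid c re x - C * P 1 x),
  (fun x => (x - c) - C *: shell_gradient re c 1 x),
  (fun x => N%:R - C * shell_laplacian re c 1 x); split.
- by rewrite paraboloid_sphere// shell_potential_sphere// mulr0 subr0.
- rewrite shell_gradient_sphere// scalerA -[X in X - _]scale1r -scalerBl.
  apply: enorm_cap_gradient_le => //; first by rewrite /C; field.
  by rewrite divr_ge0 ?mulr_ge0 ?addr_ge0 ?mulr_ge0 ?(ltW re_gt0).
move=> x capx; have xc := cap_enorm_ge capx; have x0 := cap_enorm_gt0 capx.
split.
- apply: is_grad_lapB; first exact: is_grad_lap_paraboloid.
  by apply: is_grad_lapZ; exact: is_grad_lap_shell_potential.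
- by rewrite lerBrDr gerDl mulr_ge0_le0// shell_laplacian_le0.
- have xR := cap_enorm_le capx.
  rewrite /paraboloid /shell_potential /shell_ratio expr1.
  move: (enorm _) xc x0 xR => r xc x0 xR.
  rewrite (_ : _ - _ = - ((r - re) / (2 * r) *
      ((re + d + re) * (re + d) - (r + re) * r))).
    rewrite oppr_le0 mulr_ge0 ?divr_ge0 ?subr_ge0//; first by lra.
    by rewrite ler_pM ?addr_ge0 ?lerD2r ?(ltW x0) ?(ltW re_gt0).
  by rewrite /C; field; rewrite gt_eqF.
Qed.

Lemma paraboloid_shell_laplacian_ge (k : nat) x : (N <= k + 2)%N -> cap x ->
  N%:R * P k x <= paraboloid p d x * shell_laplacian re c k x + P k x * N%:R
    + 2 * edot (x - p) (shell_gradient re c k x).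
Proof.
move=> Nk capx; have xc := cap_enorm_ge capx.
have /andP[s0 _] := shell_ratio_itv re_gt0 xc.
have lap_term : 0 <= paraboloid p d x * shell_laplacian re c k x.
  by rewrite mulr_le0 ?shell_laplacian_le0 ?paraboloid_le0//; case: capx.
have edot_term : 0 <= 2 * edot (x - p) (shell_gradient re c k x).
  rewrite linearZr_LR !mulr_ge0 ?cap_edot_ge0//= ?invr_ge0 ?sqr_ge0//.
  by rewrite exprn_ge0 ?(ltW s0).
by rewrite mulrC; lra.
Qed.

Definition cap_profile (n : nat) x : R :=
  N%:R * re ^+ 2 * (n%:R^-1 * P n x - (1 + d / re / 2) / n.+1%:R * P n.+1 x).

Definition cap_profile_gradient (n : nat) x : V :=
  (N%:R * re ^+ 2) *: (n%:R^-1 *: shell_gradient re c n x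
    - ((1 + d / re / 2) / n.+1%:R) *: shell_gradient re c n.+1 x).

Lemma cap_profile_le0 n x : (0 < n)%N -> cap x -> cap_profile n x <= 0.
Proof.
move=> n0 capx; have xc := cap_enorm_ge capx; have x0 := cap_enorm_gt0 capx.
rewrite /cap_profile mulr_ge0_le0 ?(mulr_ge0 (ler0n _ _) (sqr_ge0 _))//.
rewrite subr_le0 [leLHS]mulrC -mulrA (mulrC n.+1%:R^-1).
apply: pow_mean_le => //; first exact: shell_ratio_itv.
rewrite /shell_ratio mulrAC ler_pdivlMr// mul1r mulrDr mulr1 mulrCA divff//.
by rewrite mulr1 cap_enorm_le.
Qed.

Lemma is_grad_lap_cap_profile n x : (0 < n)%N -> N = n.+3 -> cap x ->
  is_grad_lap (cap_profile n) (cap_profile_gradient n)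
    (N%:R * s x ^+ n.+2) x.
Proof.
move=> n0 NE capx; have x0 := cap_enorm_gt0 capx.
have n_neq0 : n%:R != 0 :> R by rewrite pnatr_eq0 -lt0n.
have NR : N%:R = n%:R + 3 :> R by rewrite NE -addn3 natrD.
have lap_n : re ^+ 2 * shell_laplacian re c n x = n%:R * s x ^+ n.+2.
  rewrite /shell_laplacian NR -(addn2 n) exprD {3}/shell_ratio.
  by field; rewrite gt_eqF.
have lap_n1 : shell_laplacian re c n.+1 x = 0.
  rewrite /shell_laplacian NR -(natr1 n).
  by rewrite (_ : _ - _ - _ = 0) ?mulr0 ?mul0r//; ring.
have -> : N%:R * s x ^+ n.+2 =
    N%:R * re ^+ 2 * (n%:R^-1 * shell_laplacian re c n x
      - (1 + d / re / 2) / n.+1%:R * shell_laplacian re c n.+1 x).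
  by rewrite lap_n1 mulr0 subr0 -mulrA (mulrCA (re ^+ 2)) lap_n mulKf.
apply: is_grad_lapZ; apply: is_grad_lapB; apply: is_grad_lapZ;
  exact: is_grad_lap_shell_potential.
Qed.

(* The factor [P n.+2] costs the paraboloid [N s^(n + 2)] of its Laplacian [N],
   which is the Laplacian of the profile.  The harmonic term of the profile,
   with [P n.+1], makes it nonpositive.  A radial barrier, i.e. the torsion
   function of an annulus, would exceed the constant [N / 2] when [N > 7]. *)
Lemma has_barrier_cap_high_dim n : (0 < n)%N -> N = n.+3 ->
  has_barrier cap p (n.+2%:R * d ^+ 2 / (2 * re) + N%:R * d / 2).
Proof.
move=> n0 NE.
exists (fun x => paraboloid p d x * P n.+2 x + cap_profile n x),
  (fun x => (paraboloid p d x *: shell_gradient re c n.+2 x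
    + P n.+2 x *: (x - p)) + cap_profile_gradient n x),
  (fun x => (paraboloid p d x * shell_laplacian re c n.+2 x + P n.+2 x * N%:R
    + 2 * edot (x - p) (shell_gradient re c n.+2 x)) + N%:R * s x ^+ n.+2).
split.
- by rewrite /cap_profile !shell_potential_sphere// !mulr0 subrr mulr0 addr0.
- rewrite /cap_profile_gradient !shell_gradient_sphere//.
  rewrite shell_potential_sphere// scale0r addr0.
  rewrite !scalerA -scalerBl !scalerA -scalerDl.
  apply: enorm_cap_gradient_le.
    rewrite paraboloid_center -(natr1 n).
    by field; rewrite re_neq0 natr1 !pnatr_eq0 /= -lt0n.
  by rewrite addr_ge0 ?divr_ge0 ?mulr_ge0 ?sqr_ge0 ?(ltW re_gt0).
move=> x capx; have xc := cap_enorm_ge capx; have x0 := cap_enorm_gt0 capx.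
split.
- apply: is_grad_lapD; last exact: is_grad_lap_cap_profile.
  apply: is_grad_lapM; first exact: is_grad_lap_paraboloid.
  exact: is_grad_lap_shell_potential.
- apply: le_trans (lerD (paraboloid_shell_laplacian_ge _ capx) (lexx _)).
    by rewrite -mulrDr subrK mulr1.
  by rewrite NE addn2.
- rewrite -[leRHS]addr0 lerD ?cap_profile_le0//.
  rewrite mulr_le0_ge0 ?shell_potential_ge0//.
  by apply: paraboloid_le0; case: capx.
Qed.

End Barriers.

Lemma has_barrier_cap (R : realType) (N : nat) (d re : R) (c p : 'rV[R]_N) :
  (2 <= N)%N -> 0 <= d -> 0 < re -> enorm (p - c) = re ->
  has_barrier (exterior_cap d re c p) p (cN R N * (d * (d + re) / re)).
Proof.
move=> N2 d0 re0 pc; have re_neq0 : re != 0 by rewrite gt_eqF.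
have [N3|N4] := leqP N 3.
  apply: has_barrier_le (has_barrier_cap_low_dim d0 re0 pc N3).
  have cN_ge : 3 / 2 <= cN R N.
    rewrite /cN; case: eqVneq => // N_neq2.
    by rewrite ler_pM2r ?invr_gt0// ler_nat ltn_neqAle eq_sym N_neq2.
  apply: le_trans (_ : _ <= 3 / 2 * (d * (d + re) / re)) (ler_wpM2r _ cN_ge).
    rewrite -subr_ge0 [leRHS](_ : _ = d ^+ 2 / re); last by field.
    by rewrite divr_ge0 ?sqr_ge0 ?(ltW re0).
  by rewrite divr_ge0 ?mulr_ge0 ?addr_ge0 ?(ltW re0).
have n0 : (0 < N - 3)%N by rewrite subn_gt0.
have NE : N = (N - 3).+3 by rewrite -addn3 subnK// ltnW.
apply: has_barrier_le (has_barrier_cap_high_dim d0 re0 pc n0 NE).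
have NR : N%:R = (N - 3).+2%:R + 1 :> R by rewrite natr1 -NE.
rewrite /cN gtn_eqF 1?ltnW// -subr_ge0.
rewrite [leRHS](_ : _ = d ^+ 2 / (2 * re)); last by rewrite NR; field.
by rewrite divr_ge0 ?sqr_ge0 ?mulr_ge0 ?(ltW re0).
Qed.

Section SphereConditions.
Variables (R : realType) (N : nat).
Implicit Types (O A B : set 'rV[R]_N) (c p : 'rV[R]_N) (r : R).

Lemma enorm_contact_point A B c p r :
  eball c r `<=` A -> ecball c r `&` B = [set p] -> ~ A p -> enorm (p - c) = r.
Proof.
move=> ballA contact nAp.
have [cp _] : (ecball c r `&` B) p by rewrite contact.
by apply/eqP; rewrite eq_le cp leNgt; apply/negP => /ballA.
Qed.

Lemma interior_sphere_tangent_ball O r p : 0 < r -> interior_sphere O r ->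
  bdry O p -> exists c, interior_tangent_ball O c r p.
Proof.
move=> r0 intO bp; have [c [ballO contact]] := intO p bp.
exists c; split => //; apply: enorm_contact_point ballO contact _.
by case: bp.
Qed.

Lemma exterior_sphere_cap O r p : ebounded O -> exterior_sphere O r ->
  bdry O p -> exists c, enorm (p - c) = r /\
    closure O `<=` exterior_cap (diameter O) r c p.
Proof.
move=> bO extO bp; have [clp _] := bp.
have [c [ballC contact]] := extO p bp; exists c; split.
  by apply: enorm_contact_point ballC contact _; apply.
by move=> x clx; split; [exact: enorm_le_diameter|move=> /ballC].
Qed.

End SphereConditions.

Theorem theorem3p10 (R : realType) (N : nat) (O : set 'rV[R]_N)
  (ri re : R) (u : 'rV[R]_N -> R) (g : 'I_N -> 'rV[R]_N -> R) :
  (2 <= N)%N ->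
  bounded_domain O ->
  0 < ri -> interior_sphere O ri ->
  0 < re -> exterior_sphere O re ->
  C1_closure O u g -> C2_on O u ->
  (forall x, O x -> laplacian u x = N%:R) ->
  (forall x, bdry O x -> u x = 0) ->
  forall p, bdry O p ->
    ri <= enorm (\row_i g i p) /\
    enorm (\row_i g i p) <= cN R N * (diameter O * (diameter O + re) / re).
Proof.
move=> N2 [openO [_ [_ boundedO]]] ri0 intO re0 extO C1u C2u lapu u_bdry p bp.
have N0 : (0 < N)%N := ltnW N2.
have [ci ball_p] := interior_sphere_tangent_ball ri0 intO bp.
have [ce [pce clO_cap]] := exterior_sphere_cap boundedO extO bp.
have d0 : 0 <= diameter O by apply: diameter_ge0 boundedO (proj1 bp).
have barrier_p := has_barrier_cap N2 d0 re0 pce.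
split.
- exact: (enorm_gradient_ge_radius N0 openO boundedO C1u C2u lapu u_bdry
    ball_p).
- exact: (enorm_gradient_le_barrier N0 openO boundedO C1u C2u lapu u_bdry
    ball_p clO_cap barrier_p).
Qed.
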